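(* Let $\tau:[0,\infty)\to[0,\infty)$ be continuous with $\lim_{t\to\infty}\{t-\tau(t)\}=\infty$, and let $-\bar{\tau}=\inf_{t\ge 0}\{t-\tau(t)\}$. Let $\sigma:[-\bar\tau,\infty)\to[0,\infty)$ be continuous and such that $$\lim_{t\to\infty}\int_0^t\frac{1}{\sigma(s)}\,ds=\infty,\quad \lim_{t\to\infty}\sigma(t)=\infty,\quad \lim_{t\to\infty}\int_{t-\tau(t)}^t\frac{1}{\sigma(s)}\,ds=1,\quad \lim_{t\to\infty}\frac{\sigma(t)}{t}=\infty.$$ Let $a>b>0$ and let $g:[0,\infty)\to[0,\infty)$ be continuous with $g(0)=0$, $g(x)>0$ for $x>0$, such that there is $\delta_1>0$ with $g\in C^1(0,\delta_1)$ and $g'(x)>0$ for $x\in(0,\delta_1)$, and there is $\beta>1$ with $g'\in\mathrm{RV}_0(\beta-1)$. Let $\psi\in C([-\bar\tau,0];(0,\infty))$. If the solution $x$ of $$x'(t)=-ag(x(t))+b\max_{t-\tau(t)\le s\le t}g(x(s)),\quad t\ge 0;\qquad x(t)=\psi(t),\quad t\in[-\bar\tau,0],$$ obeys $x(t)\to0$ as $t\to\infty$, then $$\lim_{t\to\infty}\frac{\log g(x(t))}{\int_0^t\frac{1}{\sigma(s)}\,ds}=-\log\left(\frac ab\right).$$ Moreover, this limit is equivalent to $$\lim_{t\to\infty}\frac{\log x(t)}{\int_0^t\frac{1}{\sigma(s)}\,ds}=-\frac1\beta\log\left(\frac ab\right)$$ (so both limits hold).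
   Context: A function $f$, positive near $0$ on the right, is regularly varying at zero with exponent $\alpha\in\mathbb{R}$, written $f\in\mathrm{RV}_0(\alpha)$, if $\lim_{t\to0^+}f(\lambda t)/f(t)=\lambda^\alpha$ for all $\lambda>0$. A solution of the equation is a continuous function $x:[-\bar\tau,\infty)\to(0,\infty)$, differentiable on $[0,\infty)$ (one-sided at $0$), satisfying the equation for all $t\ge0$ and equal to $\psi$ on $[-\bar\tau,0]$; solutions are positive. The integrals of $1/\sigma$ over compact intervals are understood to be finite. *)

(* Defs.v *)
(* Functions on a half-line are total functions R -> R, constrained only on
   their domain. *)
From HB Require Import structures.
From mathcomp Require Import all_boot all_order all_algebra.
From mathcomp Require Import all_classical all_reals all_analysis.

Set Implicit Arguments.
Unset Strict Implicit.
Unset Printing Implicit Defensive.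

Import Order.TTheory GRing.Theory Num.Theory.
Import numFieldNormedType.Exports.

Local Open Scope classical_set_scope.
Local Open Scope ring_scope.

Definition RV0 (R : realType) (f : R -> R) (alpha : R) : Prop :=
  (\forall t \near 0^'+, 0 < f t) /\
  forall lambda : R, 0 < lambda ->
    f (lambda * t) / f t @[t --> 0^'+] --> lambda `^ alpha.

Definition taubar (R : realType) (tau : R -> R) : R :=
  - inf [set t - tau t | t in `[0, +oo[].

(* The inverse is taken in \bar R, where 0^-1 = +oo, so that zeros of sigma are
   not silently ignored (in R one would have 0^-1 = 0). *)
Definition recip_int_ereal (R : realType) (sigma : R -> R) (c d : R) : \bar R :=
  (\int[lebesgue_measure]_(s in `[c, d]) ((sigma s)%:E)^-1)%E.

(* Only meaningful when recip_int_ereal sigma c d is finite. *)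
Definition recip_int (R : realType) (sigma : R -> R) (c d : R) : R :=
  fine (recip_int_ereal sigma c d).

(* The supremum is a maximum whenever f is continuous on [c, d], c <= d. *)
Definition max_on (R : realType) (c d : R) (f : R -> R) : R :=
  sup [set f s | s in `[c, d]].

Definition rhs (R : realType) (tau : R -> R) (a b : R) (g x : R -> R) (t : R) : R :=
  - a * g (x t) + b * max_on (t - tau t) t (g \o x).

(* At t = 0 the derivative is the right-hand one. *)
Definition is_solution (R : realType) (tau : R -> R) (a b : R)
    (g psi x : R -> R) : Prop :=
  [/\ {within `[- taubar tau, +oo[, continuous x},
      forall t : R, - taubar tau <= t -> 0 < x t,
      h^-1 * (x h - x 0) @[h --> 0^'+] --> rhs tau a b g x 0,
      forall t : R, 0 < t -> is_derive t 1 x (rhs tau a b g x t) &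
      forall t : R, - taubar tau <= t <= 0 -> x t = psi t].

(* Main.v *)
Require Import Defs.
From HB Require Import structures.
From mathcomp Require Import all_boot all_order all_algebra.
From mathcomp Require Import all_classical all_reals all_analysis measurable_realfun.
From mathcomp Require Import ring lra.

Set Implicit Arguments.
Unset Strict Implicit.
Unset Printing Implicit Defensive.

Import Order.TTheory GRing.Theory Num.Theory.
Import numFieldNormedType.Exports.

Local Open Scope classical_set_scope.
Local Open Scope ring_scope.

(** Write I(t) for the integral of 1/sigma over [0,t] and r = ln(a/b)/beta. The
    claim for ln x says that x decays like exp(-r I(t)) on the logarithmic
    scale; it is proved by comparing x with the barriers A exp(-rho I(t)).

    Since I(t) - I(t - tau t) tends to 1, over one delay interval the barrier
    varies by a factor close to e^rho, hence, g being regularly varying of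
    exponent beta, its image under g varies by a factor close to e^(rho beta).
    Suppose that x meets the barrier at t for the first time.

    - If rho > r (lower barrier), the maximum of g(x) over the delay interval is
      at least g(x(t - tau t)), which is larger than (a/b) g(x(t)); therefore
      x'(t) > 0, whereas the barrier is nonincreasing, so x was below it just
      before t ([ln_x_ge]).
    - If rho < r (upper barrier), that maximum is at most M g(x(t)) with
      M < a/b; therefore (ln x)'(t) <= - kappa g(x(t))/x(t) with kappa > 0. As g
      decays no faster than a power, g(x)/x is at least a multiple of
      x^beta = A^beta exp(-rho beta I(t)). Because sigma(t)/t tends to
      infinity, I(t) grows more slowly than any multiple of ln t, so this is at
      least a multiple of 1/t, and I increases more slowly than any multiple
      of ln near t. So x decreases faster than the barrier at t, and was above
      it just before ([ln_x_le]).

    Only one value of lambda at a time is needed in g(lambda z)/g(z), so no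
    uniform convergence theorem enters; and g inherits regular variation from
    g' by comparing derivatives ([rv_lincomb]). The barriers are written
    additively, as lower bounds for ln x + rho I or its opposite, and the first
    meeting argument is [barrier], put into asymptotic form in
    [eventual_lower_bound].

    Letting rho tend to r from both sides gives the limit for ln x
    ([cvg_ratio]). The limit for ln g(x) follows from ln g(z)/ln z -> beta as z
    tends to 0 ([ln_g_ratio]), again a consequence of regular variation along
    the single ratio 1/2 together with the monotonicity of g. *)

(** * Neighbourhood filters and limits of quotients *)

Lemma near_pinfty_ex (R : realType) (P : R -> Prop) :
  (\forall t \near +oo, P t) -> exists2 T : R, 0 < T & forall t, T <= t -> P t.
Proof.
move=> [M [_ MP]]; exists (`|M| + 1) => [|t Mt].
  by rewrite ltr_wpDl.
by apply: MP; rewrite (lt_le_trans _ Mt)// ltr_pwDr// ler_norm.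
Qed.

Lemma near_right0_ex (R : realType) (P : R -> Prop) :
  (\forall z \near 0^'+, P z) ->
  exists2 d : R, 0 < d & forall z, 0 < z -> z < d -> P z.
Proof.
move=> [d /= d0 dP]; exists d => // z z0 zd; apply: dP => //=.
by rewrite sub0r normrN gtr0_norm.
Qed.

Lemma right0_near (R : realType) (P : R -> Prop) (d : R) : 0 < d ->
  (forall z, 0 < z -> z < d -> P z) -> \forall z \near 0^'+, P z.
Proof.
move=> d0 dP; near=> z; apply: dP => //.
Unshelve. all: end_near. Qed.

(** The additive constants K are negligible against v, so bounds of slope
    arbitrarily close to l on either side determine the limit of u/v. *)
Lemma cvg_ratio (R : realType) (T : Type) (F : set_system T) (FF : Filter F)
    (u v : T -> R) (l d : R) : 0 < d -> v t @[t --> F] --> +oo ->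
  (forall s, l < s < l + d -> exists K, \forall t \near F, u t <= s * v t + K) ->
  (forall s, l - d < s < l -> exists K, \forall t \near F, s * v t + K <= u t) ->
  u t / v t @[t --> F] --> l.
Proof.
move=> d0 /cvgryPge voo ub lb; apply/cvgrPdist_le => e e0.
pose h := Num.min (e / 2) (d / 2).
have h0 : 0 < h by rewrite lt_min !divr_gt0.
have [he hd] : h <= e / 2 /\ h <= d / 2 by split; rewrite ge_min lexx ?orbT.
have [|K1 HK1] := ub (l + h); first by rewrite ltrDl h0 ltrD2l; lra.
have [|K2 HK2] := lb (l - h); first by lra.
near=> t.
have v1 : 1 <= v t by near: t; exact: voo.
have v2 : `|K1| <= e / 2 * v t.
  rewrite mulrC -ler_pdivrMr ?divr_gt0//; near: t; exact: voo.
have v3 : `|K2| <= e / 2 * v t.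
  rewrite mulrC -ler_pdivrMr ?divr_gt0//; near: t; exact: voo.
have u1 : u t <= (l + h) * v t + K1 by near: t.
have u2 : (l - h) * v t + K2 <= u t by near: t.
have v0 : 0 < v t by exact: lt_le_trans v1.
have := ler_norm K1; have := ler_norm (- K2); rewrite normrN => n2 n1.
rewrite ler_distlC; apply/andP; split.
  by rewrite ler_pdivlMr//; nra.
by rewrite ler_pdivrMr//; nra.
Unshelve. all: end_near. Qed.

(** * The integral of the reciprocal of sigma *)

Section recip_integral.
Variables (R : realType) (sigma : R -> R) (c0 : R).
Hypothesis sigma_cont : {within `[c0, +oo[, continuous sigma}.
Hypothesis sigma_ge0 : forall t : R, c0 <= t -> 0 <= sigma t.
Hypothesis sigma_fin : forall c d : R, c0 <= c -> c <= d ->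
  (recip_int_ereal sigma c d < +oo)%E.

(** The reciprocal in the extended reals takes the value +oo at the zeros of
    sigma; elsewhere it is the power of exponent -1, which is measurable. *)
Lemma measurable_recip (D : set R) : measurable D -> D `<=` `[c0, +oo[ ->
  measurable_fun D (fun s : R => (((sigma s)%:E)^-1)%E : \bar R).
Proof.
move=> mD Dc0.
have msigma : measurable_fun D sigma.
  apply: (@measurable_funS _ _ _ _ `[c0, +oo[) => //.
  exact: subspace_continuous_measurable_fun.
have -> : (fun s => ((sigma s)%:E)^-1%E) =
    (fun s => if sigma s == 0 then +oo%E else ((sigma s)^-1)%:E).
  by apply/funext => s; rewrite inver.
apply: measurable_fun_if => //.
- exact: measurable_fun_eqr.
- set E := (X in measurable_fun X); have mE : measurable E.
    by apply: measurable_fun_eqr.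
  apply/measurable_EFinP.
  apply: (@eq_measurable_fun _ _ _ _ _ (fun s => sigma s `^ (-1))).
    move=> s /[!inE] -[Ds _]; rewrite powR_inv1//; apply: sigma_ge0.
    by have := Dc0 _ Ds; rewrite /= in_itv/= andbT.
  apply: (@measurableT_comp _ _ _ _ _ _ (@powR R ^~ (-1))).
    exact: measurable_powR.
  by apply: measurable_funS msigma => // s [].
Qed.

Lemma recip_ge0 s : c0 <= s -> (0 <= ((sigma s)%:E)^-1)%E.
Proof. by move=> cs; rewrite inve_ge0 lee_fin sigma_ge0. Qed.

Lemma recip_int_ereal_ge0 s t : c0 <= s -> (0 <= recip_int_ereal sigma s t)%E.
Proof.
move=> cs; apply: integral_ge0 => r /=; rewrite in_itv/= => /andP[sr _].
exact/recip_ge0/(le_trans cs).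
Qed.

Lemma recip_int_ge0 s t : c0 <= s -> 0 <= recip_int sigma s t.
Proof. by move=> cs; exact/fine_ge0/recip_int_ereal_ge0. Qed.

(** Additivity is transferred from the extended reals, where it holds for
    nonnegative functions; [fine] is additive on finite values only. *)
Lemma recip_int_split r s t : c0 <= r -> r <= s -> s <= t ->
  recip_int sigma r t = recip_int sigma r s + recip_int sigma s t.
Proof.
move=> cr rs st.
have sub (b0 b1 : bool) (u v : R) : c0 <= u ->
    [set` Interval (BSide b0 u) (BSide b1 v)] `<=` `[c0, +oo[.
  move=> cu w /=; rewrite !in_itv/= andbT => /andP[uw _].
  by rewrite (le_trans cu)//; case: b0 uw => //= /ltW.
have cs := le_trans cr rs.
have split_ereal : recip_int_ereal sigma r t =
    (recip_int_ereal sigma r s + recip_int_ereal sigma s t)%E.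
  rewrite /recip_int_ereal.
  have -> : `[r, t]%classic = `[r, s[%classic `|` `[s, t]%classic.
    by rewrite -itv_bndbnd_setU// bnd_simp.
  rewrite ge0_integral_setU//; first last.
  - apply/disj_setPLR => u /=; rewrite !in_itv/= => /andP[_ us].
    by move=> /andP[su _]; rewrite leNgt us in su.
  - move=> u [] /=; rewrite in_itv/= => /andP[ru _]; apply: recip_ge0.
      exact: le_trans ru.
    exact: le_trans ru.
  - apply: measurable_recip; first exact: measurableU.
    by move=> u []; apply: sub.
  rewrite integral_itv_bndo_bndc//.
  by apply: measurable_recip => //; apply: sub.
rewrite /recip_int split_ereal fineD//; rewrite fin_numElt;
  by rewrite (lt_le_trans _ (recip_int_ereal_ge0 _ _))//= ?ltNy0// sigma_fin.
Qed.

End recip_integral.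

Lemma integral_inv (R : realType) (eps s t : R) : 0 < s -> s < t ->
  (\int[lebesgue_measure]_(r in `[s, t]) (eps * r^-1)%:E)%E =
    (eps * (ln t - ln s))%:E.
Proof.
move=> s0 st.
have gt0 (r : R) : r \in `[s, t] -> 0 < r.
  by rewrite in_itv/= => /andP[sr _]; exact: lt_le_trans sr.
have d (r : R) : 0 < r -> is_derive r 1 (fun r => eps * ln r) (eps * r^-1).
  by move=> r0; apply: is_deriveZ; exact: is_derive1_ln.
have c (r : R) : 0 < r -> {for r, continuous (fun r => eps * ln r)}.
  move=> r0; apply: cvgM; first exact: cvg_cst.
  exact: continuous_ln.
rewrite (@continuous_FTC2 _ _ (fun r => eps * ln r))//.
- by rewrite -EFinB -mulrBr.
- apply: continuous_in_subspaceT => r /[!inE] /gt0 r0.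
  apply: cvgM; first exact: cvg_cst.
  by apply: cvgV => //; rewrite gt_eqF.
- split.
  + move=> r rst; have [] // := d r.
    by apply: gt0; exact: subset_itv_oo_cc.
  + by apply: cvg_at_right_filter; exact: c.
  + by apply: cvg_at_left_filter; exact/c/(lt_trans s0).
- move=> r rst; rewrite derive1E.
  by have [] // := d r; apply: gt0; exact: subset_itv_oo_cc.
Qed.

(** Eventually 1/sigma(r) <= eps/r, and eps/r integrates to a logarithm. *)
Lemma recip_int_le_ln (R : realType) (sigma : R -> R) (c0 eps : R) :
  {within `[c0, +oo[, continuous sigma} ->
  (forall t : R, c0 <= t -> 0 <= sigma t) -> c0 <= 0 ->
  sigma t / t @[t --> +oo] --> +oo -> 0 < eps ->
  exists2 T : R, 0 < T & forall s t, T <= s -> s <= t ->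
    recip_int sigma s t <= eps * (ln t - ln s).
Proof.
move=> sigma_cont sigma_ge0 c00 /cvgryPge/(_ eps^-1)/near_pinfty_ex[T T0 HT] e0.
exists T => // s t Ts; rewrite le_eqVlt => /predU1P[->|st].
  by rewrite /recip_int /recip_int_ereal set_itv1 integral_set1/= subrr mulr0.
have s0 := lt_le_trans T0 Ts.
have le_e : (recip_int_ereal sigma s t <= (eps * (ln t - ln s))%:E)%E.
  rewrite -integral_inv//; apply: ge0_le_integral => //.
  - move=> r /=; rewrite in_itv/= => /andP[sr _].
    by apply: (recip_ge0 sigma_ge0); rewrite (le_trans c00)// (le_trans (ltW s0)).
  - apply: (measurable_recip sigma_cont) => // r /=.
    rewrite !in_itv/= andbT => /andP[sr _].
    by rewrite (le_trans c00)// (le_trans (ltW s0)).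
  - apply/measurable_EFinP; apply: subspace_continuous_measurable_fun => //.
    apply: continuous_in_subspaceT => r /[!inE] /=.
    rewrite in_itv/= => /andP[sr _].
    apply: cvgM; first exact: cvg_cst.
    by apply: cvgV => //; rewrite gt_eqF// (lt_le_trans s0).
  - move=> r /=; rewrite in_itv/= => /andP[sr _].
    have r0 : 0 < r by exact: lt_le_trans sr.
    have := HT _ (le_trans Ts sr); rewrite ler_pdivlMr// => h.
    have sr0 : 0 < sigma r by apply: lt_le_trans h; rewrite mulr_gt0 ?invr_gt0.
    rewrite inver gt_eqF// lee_fin -[leRHS]invrK lef_pV2 ?posrE//.
      by rewrite invfM invrK.
    by rewrite invr_gt0 mulr_gt0 ?invr_gt0.
have ge0 : (0 <= recip_int_ereal sigma s t)%E.
  by apply: (recip_int_ereal_ge0 sigma_ge0); rewrite (le_trans c00)// ltW.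
rewrite -lee_fin fineK// fin_numElt (lt_le_trans _ ge0)//=.
exact: le_lt_trans le_e (ltry _).
Qed.

(** * Regular variation at zero *)

Section regular_variation.
Variables (R : realType) (g : R -> R) (delta1 beta : R).
Hypothesis g_cont : {within `[0, +oo[, continuous g}.
Hypothesis g0 : g 0 = 0.
Hypothesis g_gt0 : forall u : R, 0 < u -> 0 < g u.
Hypothesis delta1_gt0 : 0 < delta1.
Hypothesis g_derivable : forall u : R, 0 < u < delta1 -> derivable g u 1.
Hypothesis g'_gt0 : forall u : R, 0 < u < delta1 -> 0 < derive1 g u.
Hypothesis g'_RV : RV0 (derive1 g) (beta - 1).

Lemma g_nondecr u v : 0 <= u -> u <= v -> v < delta1 -> g u <= g v.
Proof.
move=> u0 uv vd.
apply: (@ger0_derive1_le_co _ g 0 delta1) => //.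
- by move=> z; rewrite in_itv/= => /g'_gt0/ltW.
- apply: continuous_subspaceW g_cont => z /=.
  by rewrite !in_itv/= => /andP[->].
- by rewrite in_itv/= u0 (le_lt_trans uv).
- by rewrite in_itv/= (le_trans u0).
Qed.

(** Regular variation of g at a fixed ratio, in a form that gives upper and
    lower bounds of g(lambda z)/g(z) at once (p = M, q = -1 or p = -M, q = 1).
    The combination vanishes at 0, and its derivative is g'(z) times
    p + q lambda g'(lambda z)/g'(z), which tends to p + q lambda^beta > 0. *)
Lemma rv_lincomb (lambda p q : R) : 0 < lambda -> 0 < p + q * lambda `^ beta ->
  \forall z \near 0^'+, 0 <= p * g z + q * g (lambda * z).
Proof.
move=> l0 pq; have [_ /(_ _ l0) rv] := g'_RV.
pose h z := p * g z + q * g (lambda * z).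
have cvgh : p + q * lambda * (derive1 g (lambda * z) / derive1 g z) @[z --> 0^'+] -->
    p + q * lambda `^ beta.
  have -> : lambda `^ beta = lambda * lambda `^ (beta - 1).
    rewrite -{2}(powRr1 (ltW l0)) -powRD ?(lt0r_neq0 l0) ?implybT//.
    by rewrite addrCA subrr addr0.
  by rewrite mulrA; apply: cvgD; [exact: cvg_cst|apply: cvgM => //; exact: cvg_cst].
have [d d0 dP] := near_right0_ex (cvgr_gt _ cvgh _ pq).
pose e := Num.min d (Num.min delta1 (delta1 / lambda)).
have e0 : 0 < e by rewrite !lt_min d0 delta1_gt0 divr_gt0.
have cg z : 0 < z -> {for z, continuous g}.
  move=> z0; have [cg _] := (continuous_within_itvcyP _ _).1 g_cont.
  by apply: cg; rewrite in_itv/= z0.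
have dh z : 0 < z < e ->
    is_derive z 1 h (p * derive1 g z + q * (derive1 g (lambda * z) * lambda)).
  rewrite !lt_min => /andP[z0 /and3P[zd zd1 zl]].
  have lz : 0 < lambda * z < delta1 by rewrite mulr_gt0//= mulrC -ltr_pdivlMr.
  have d1 : is_derive z 1 g (derive1 g z).
    by rewrite derive1E; exact/derivableP/g_derivable/andP.
  have d2 : is_derive (lambda * z) 1 g (derive1 g (lambda * z)).
    by rewrite derive1E; exact/derivableP/g_derivable.
  have d3 : is_derive z 1 (fun z => lambda * z) lambda.
    rewrite -[X in is_derive _ _ _ X]mulr1.
    by apply: is_deriveZ; exact: is_derive_id.
  have d4 := is_derive1_comp d2 d3.
  by apply: is_deriveD; apply: is_deriveZ => //; exact: d4.
apply: (right0_near e0) => z z0 ze.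
rewrite -[leRHS]/(h z) (_ : 0 = h 0); last by rewrite /h mulr0 g0 !mulr0 addr0.
apply: (@ger0_derive1_le_co _ h 0 e) => //; last 3 first.
- by rewrite in_itv/= lexx.
- by rewrite in_itv/= ltW.
- exact: ltW.
- by move=> u /[!in_itv]/= /dh [].
- move=> u; rewrite in_itv/= => ue; rewrite derive1E; have [_ ->] := dh _ ue.
  move: ue; rewrite !lt_min => /andP[u0 /and3P[ud ud1 _]].
  have g'u : 0 < derive1 g u by apply: g'_gt0; rewrite u0.
  have := dP _ u0 ud; rewrite -(pmulr_rgt0 _ g'u) => /ltW/le_trans; apply.
  by rewrite le_eqVlt; apply/orP; left; apply/eqP; field; rewrite gt_eqF.
- apply: continuous_subspaceW (_ : `[0, e[ `<=` `[0, +oo[) _.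
    by move=> u /=; rewrite !in_itv/= => /andP[->].
  have [_ cg0] := (continuous_within_itvcyP _ _).1 g_cont.
  apply/continuous_within_itvcyP; split.
    move=> u; rewrite in_itv/= andbT => u0; apply: cvgD.
      by apply: cvgM; [exact: cvg_cst|exact: cg].
    apply: cvgM; first exact: cvg_cst.
    apply: (@continuous_comp _ _ _ (fun z => lambda * z) g).
      by apply: cvgM; [exact: cvg_cst|exact: cvg_id].
    by apply: cg; rewrite mulr_gt0.
  rewrite /h mulr0; apply: cvgD; first by apply: cvgM => //; exact: cvg_cst.
  apply: cvgM; first exact: cvg_cst.
  apply: (@cvg_comp _ _ _ (fun z => lambda * z) g _ (0^'+)) => // P [d' /= d'0 d'P].
  apply: (@right0_near _ _ (d' / lambda)); first exact: divr_gt0.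
  move=> u u0 ud'; apply: d'P => /=; last by rewrite mulr_gt0.
  by rewrite sub0r normrN gtr0_norm ?mulr_gt0// mulrC -ltr_pdivlMr.
Qed.

(** Repeated halving of the points of [d/2, d] reaches all of (0, d]. *)
Lemma dyadic_bound (phi : R -> R) (d K : R) : 0 < d ->
  (forall z, 0 < z <= d -> phi (z / 2) <= phi z) ->
  (forall z, d / 2 <= z <= d -> phi z <= K) ->
  forall z, 0 < z <= d -> phi z <= K.
Proof.
move=> d0 half base z /andP[z0 zd].
have ind n : forall u, d / 2 ^+ n.+1 <= u <= d -> phi u <= K.
  elim: n => [|n IHn] u; first by rewrite expr1; exact: base.
  move=> /andP[du ud]; have [d2u|ud2] := leP (d / 2 ^+ n.+1) u.
    by apply: IHn; rewrite d2u.
  have u0 : 0 < u by apply: lt_le_trans du; rewrite divr_gt0// exprn_gt0.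
  have u2d : 2 * u <= d.
    rewrite mulrC -ler_pdivlMr//; apply: (le_trans (ltW ud2)).
    rewrite ler_pM2l// lef_pV2 ?posrE ?exprn_gt0//.
    by rewrite exprS ler_peMr// exprn_ege1// ler1n.
  have -> : u = 2 * u / 2 by rewrite mulrC mulKf.
  apply: (le_trans (half _ _)); first by rewrite mulr_gt0.
  apply: IHn; rewrite u2d andbT.
  by move: du; rewrite (exprS _ n.+1) invfM mulrCA ler_pdivrMl.
have [n dn] : exists n, d / z <= 2 ^+ n.+1.
  exists (Num.truncn (d / z)); rewrite (le_trans (ltW (truncnS_gt _)))//.
  rewrite -natrX ler_nat; exact/ltnW/ltn_expl.
apply: (ind n); rewrite zd andbT ler_pdivrMr ?exprn_gt0//.
by rewrite mulrC -ler_pdivrMr.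
Qed.

(** ln g(z) - s ln z decreases when z is halved because 2^(-s) > 2^(-beta), and
    it is bounded on [e/2, e] because g is monotone there. *)
Lemma ln_g_le s : s < beta ->
  exists K, \forall z \near 0^'+, ln (g z) <= s * ln z + K.
Proof.
move=> sb.
have h0 : 0 < (2^-1 : R) by rewrite invr_gt0.
have pos : 0 < 2^-1 `^ s + (-1) * 2^-1 `^ beta.
  rewrite mulN1r subr_gt0 -ltr_ln ?posrE ?powR_gt0// !ln_powR.
  by rewrite lnV ?posrE// ltr_nM2r// oppr_lt0 ln_gt0 ?ltr1n.
have [d d0 dP] := near_right0_ex (rv_lincomb h0 pos).
pose e := Num.min (d / 2) (delta1 / 2).
have e0 : 0 < e by rewrite lt_min !divr_gt0.
exists (ln (g e) - s * ln e + `|s| * ln 2).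
apply: (right0_near e0) => z z0 ze; rewrite -lerBlDl.
have ez w : w <= e -> w < d /\ w < delta1.
  rewrite le_min => /andP[w1 w2].
  split; [apply: (le_lt_trans w1)|apply: (le_lt_trans w2)];
    by rewrite ltr_pdivrMr// ltr_pMr ?ltr1n.
apply: (@dyadic_bound (fun z => ln (g z) - s * ln z) e) => //; last first.
- by rewrite z0 ltW.
- move=> w /andP[ew we]; have w0 : 0 < w by apply: lt_le_trans ew; rewrite divr_gt0.
  have ln1 : ln (g w) <= ln (g e).
    rewrite ler_ln ?posrE ?g_gt0//; apply: g_nondecr => //; first exact: ltW.
    by have [] := ez e (lexx _).
  have ln2 : ln w <= ln e by rewrite ler_ln ?posrE.
  have ln3 : ln e - ln 2 <= ln w.
    by rewrite -ln_div ?posrE// ler_ln ?posrE ?divr_gt0.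
  have := ler_norm s; have := ler_norm (- s); rewrite normrN => sN sP.
  nra.
- move=> w /andP[w0 we]; have [wd wd1] := ez _ we.
  have := dP _ w0 wd; rewrite mulN1r subr_ge0 (mulrC 2^-1 w) => gw.
  have w20 : 0 < w / 2 by rewrite divr_gt0.
  have : ln (g (w / 2)) <= ln (2^-1 `^ s * g w).
    by rewrite ler_ln ?posrE ?mulr_gt0 ?powR_gt0 ?g_gt0.
  rewrite (@lnM _ (2^-1 `^ s)) ?posrE ?powR_gt0 ?g_gt0// ln_powR lnV ?posrE//.
  by rewrite (@ln_div _ w 2) ?posrE//; lra.
Qed.

(** The mirror image of [ln_g_le], with 2^(-s) < 2^(-beta). *)
Lemma ln_g_ge s : beta < s ->
  exists K, \forall z \near 0^'+, s * ln z + K <= ln (g z).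
Proof.
move=> sb.
have h0 : 0 < (2^-1 : R) by rewrite invr_gt0.
have pos : 0 < - 2^-1 `^ s + 1 * 2^-1 `^ beta.
  rewrite mul1r addrC subr_gt0 -ltr_ln ?posrE ?powR_gt0// !ln_powR.
  by rewrite lnV ?posrE// ltr_nM2r// oppr_lt0 ln_gt0 ?ltr1n.
have [d d0 dP] := near_right0_ex (rv_lincomb h0 pos).
pose e := Num.min (d / 2) (delta1 / 2).
have e0 : 0 < e by rewrite lt_min !divr_gt0.
exists (- (`|s| * ln 2 + s * ln e - ln (g (e / 2)))).
apply: (right0_near e0) => z z0 ze.
have ez w : w <= e -> w < d /\ w < delta1.
  rewrite le_min => /andP[w1 w2].
  split; [apply: (le_lt_trans w1)|apply: (le_lt_trans w2)];
    by rewrite ltr_pdivrMr// ltr_pMr ?ltr1n.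
suff : s * ln z - ln (g z) <= `|s| * ln 2 + s * ln e - ln (g (e / 2)) by lra.
apply: (@dyadic_bound (fun z => s * ln z - ln (g z)) e) => //; last first.
- by rewrite z0 ltW.
- move=> w /andP[ew we]; have w0 : 0 < w by apply: lt_le_trans ew; rewrite divr_gt0.
  have ln1 : ln (g (e / 2)) <= ln (g w).
    rewrite ler_ln ?posrE ?g_gt0 ?divr_gt0//; apply: g_nondecr => //.
      by rewrite divr_ge0// ltW.
    by have [] := ez w we.
  have ln2 : ln w <= ln e by rewrite ler_ln ?posrE.
  have ln3 : ln e - ln 2 <= ln w.
    by rewrite -ln_div ?posrE// ler_ln ?posrE ?divr_gt0.
  have := ler_norm s; have := ler_norm (- s); rewrite normrN => sN sP.
  nra.
- move=> w /andP[w0 we]; have [wd wd1] := ez _ we.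
  have := dP _ w0 wd; rewrite mulNr mul1r addrC subr_ge0 (mulrC 2^-1 w) => gw.
  have w20 : 0 < w / 2 by rewrite divr_gt0.
  have : ln (2^-1 `^ s * g w) <= ln (g (w / 2)).
    by rewrite ler_ln ?posrE ?mulr_gt0 ?powR_gt0 ?g_gt0.
  rewrite (@lnM _ (2^-1 `^ s)) ?posrE ?powR_gt0 ?g_gt0// ln_powR lnV ?posrE//.
  by rewrite (@ln_div _ w 2) ?posrE//; lra.
Qed.

End regular_variation.

Lemma ln_g_ratio (R : realType) (g : R -> R) (delta1 beta : R) :
  {within `[0, +oo[, continuous g} -> g 0 = 0 ->
  (forall u : R, 0 < u -> 0 < g u) -> 0 < delta1 ->
  (forall u : R, 0 < u < delta1 -> derivable g u 1) ->
  (forall u : R, 0 < u < delta1 -> 0 < derive1 g u) ->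
  RV0 (derive1 g) (beta - 1) ->
  ln (g z) / ln z @[z --> 0^'+] --> beta.
Proof.
move=> g_cont g0 g_gt0 delta1_gt0 dg g'_gt0 g'_RV.
rewrite -[X in _ --> X]opprK.
have -> : (fun z : R => ln (g z) / ln z) = (fun z => - (ln (g z) / - ln z)).
  by apply/funext => z; rewrite invrN mulrN opprK.
apply: cvgN; apply: (@cvg_ratio _ _ _ _ _ _ _ 1) => //.
- by apply/cvgNry; exact: lnNy.
- move=> s /andP[bs _]; have sb : - s < beta by rewrite ltrNl.
  have [K HK] := ln_g_le g_cont g0 g_gt0 delta1_gt0 dg g'_gt0 g'_RV sb.
  by exists K; apply: filterS HK => z; rewrite mulNr mulrN.
- move=> s /andP[_ bs]; have sb : beta < - s by rewrite ltrNr.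
  have [K HK] := ln_g_ge g_cont g0 g_gt0 delta1_gt0 dg g'_gt0 g'_RV sb.
  by exists K; apply: filterS HK => z; rewrite mulNr mulrN.
Qed.

(** * First-passage argument *)

Lemma derive_gt0_left (R : realType) (f : R -> R) (t D c : R) :
  is_derive t 1 f D -> 0 < D -> c < t -> exists2 s, c < s < t & f s < f t.
Proof.
move=> [df Df] D0 ct.
have cD : h^-1 *: ((f \o shift t) (h *: 1) - f t) @[h --> 0^'] --> D.
  by rewrite -Df; exact: df.
have [e /= e0 eP] := cvgr_gt _ cD _ D0.
pose h := Num.min (e / 2) ((t - c) / 2).
have h0 : 0 < h by rewrite lt_min !divr_gt0// subr_gt0.
have he : h <= e / 2 by rewrite ge_min lexx.
have hc : h <= (t - c) / 2 by rewrite ge_min lexx orbT.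
exists (t - h); first by apply/andP; split; lra.
have := eP (- h).
rewrite /= sub0r opprK gtr0_norm// /shift /= oppr_eq0 gt_eqF//.
rewrite {1}/GRing.scale/= /GRing.scale/= mulr1 invrN mulNr oppr_gt0.
rewrite (addrC (- h)) pmulr_rlt0 ?invr_gt0// subr_lt0; apply => //.
by apply: (le_lt_trans he); rewrite ltr_pdivrMr// ltr_pMr ?ltr1n.
Qed.

(** First-passage principle: d starts positive on (T0, T1], and whenever it
    reaches 0 from above it must already have been negative, which is absurd
    at the first zero. *)
Lemma barrier (R : realType) (d : R -> R) (T0 T1 : R) : T0 < T1 ->
  (forall t, T0 < t -> {for t, continuous d}) ->
  (forall t, T0 < t <= T1 -> 0 < d t) ->
  (forall t, T1 < t -> d t = 0 -> (forall s, T0 < s <= t -> 0 <= d s) ->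
    exists2 s, T0 < s < t & d s < 0) ->
  forall t, T0 < t -> 0 <= d t.
Proof.
move=> T01 cd init step t tT; rewrite leNgt; apply/negP => dt.
pose S := [set s | T0 < s /\ d s < 0].
have lbS : lbound S T1.
  move=> s [Ts ds]; rewrite leNgt; apply/negP => sT1.
  by have := init s; rewrite Ts ltW// => /(_ isT)/(lt_trans ds); rewrite ltxx.
have S0 : S !=set0 by exists t.
have hS : has_inf S by split => //; exists T1.
pose m := inf S.
have T1m : T1 <= m by exact: lb_le_inf.
have T0m : T0 < m by exact: lt_le_trans T1m.
have before s : T0 < s -> s < m -> 0 <= d s.
  move=> Ts sm; rewrite leNgt; apply/negP => ds.
  have : m <= s by apply: ge_inf; [exists T1|].
  by rewrite leNgt sm.
have dm_le0 : d m <= 0.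
  rewrite leNgt; apply/negP => dm.
  have [e /= e0 eP] := cvgr_gt _ (cd _ T0m) _ dm.
  have [s [Ts ds] sm] := inf_adherent e0 hS.
  have ms : m <= s by apply: ge_inf; [exists T1|].
  have := eP s; rewrite /= distrC ger0_norm ?subr_ge0// ltrBlDl => /(_ sm).
  by move=> /(lt_trans ds); rewrite ltxx.
have dm_ge0 : 0 <= d m.
  rewrite leNgt; apply/negP => dm.
  have [e /= e0 eP] := cvgr_lt _ (cd _ T0m) _ dm.
  pose h := Num.min (e / 2) ((m - T0) / 2).
  have h0 : 0 < h by rewrite lt_min !divr_gt0// subr_gt0.
  have he : h <= e / 2 by rewrite ge_min lexx.
  have hc : h <= (m - T0) / 2 by rewrite ge_min lexx orbT.
  have : 0 <= d (m - h) by apply: before; lra.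
  rewrite leNgt => /negP; apply; apply: eP => /=.
  rewrite opprD addrA subrr sub0r opprK gtr0_norm//.
  by apply: (le_lt_trans he); rewrite ltr_pdivrMr// ltr_pMr ?ltr1n.
have dm : d m = 0 by apply/le_anti/andP.
have T1m' : T1 < m.
  rewrite lt_neqAle T1m andbT; apply/eqP => mT1.
  by have := init T1; rewrite T01 lexx => /(_ isT); rewrite mT1 dm ltxx.
have [|s /andP[Ts sm] ds] := step m T1m' dm.
  move=> s /andP[Ts]; rewrite le_eqVlt => /predU1P[->//|]; exact: before.
by have := before _ Ts sm; rewrite leNgt ds.
Qed.

(** [barrier] applied to w - K, with K chosen below the minimum of w on a first
    stretch [T0, T1] long enough for the delayed argument to stay beyond T0
    afterwards. The property P collects whatever the contradiction needs to
    hold from T0 on; the sign of K is what lets the constant be discarded in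
    the estimate of the decay rate. *)
Lemma eventual_lower_bound (R : realType) (tau w : R -> R) (P : R -> Prop) :
  t - tau t @[t --> +oo] --> +oo ->
  (\forall t \near +oo, {for t, continuous w}) ->
  (\forall t \near +oo, P t) ->
  (forall K T0 t, K <= 0 -> 0 < T0 -> T0 < t - tau t -> T0 < t ->
    (forall s, T0 <= s -> P s) -> w t = K ->
    (forall s, T0 < s <= t -> K <= w s) ->
    exists2 s, T0 < s < t & w s < K) ->
  exists K, \forall t \near +oo, K <= w t.
Proof.
move=> /cvgryPge tau_lim /near_pinfty_ex[Tc Tc0 HTc] /near_pinfty_ex[TP TP0 HTP].
move=> step; pose T0 := Num.max Tc TP.
have T0_gt0 : 0 < T0 by rewrite lt_max Tc0.
have cw t : T0 <= t -> {for t, continuous w}.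
  by rewrite ge_max => /andP[/HTc].
have PT0 t : T0 <= t -> P t by rewrite ge_max => /andP[_ /HTP].
have [T2 T20 HT2] := near_pinfty_ex (tau_lim (T0 + 1)).
pose T1 := Num.max (T0 + 1) T2.
have T01 : T0 + 1 <= T1 by rewrite le_max lexx.
have T21 : T2 <= T1 by rewrite le_max lexx orbT.
have T01' : T0 < T1 by apply: lt_le_trans T01; rewrite ltrDl.
have [|c cT cmin] := @EVT_min _ w T0 T1 (ltW T01').
  apply: continuous_in_subspaceT => r /[!inE] /=; rewrite in_itv/= => /andP[Tr _].
  exact: cw.
pose K := Num.min (w c - 1) 0.
have K0 : K <= 0 by rewrite ge_min lexx orbT.
have Kc : K <= w c - 1 by rewrite ge_min lexx.
exists K; near=> t; rewrite -subr_ge0.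
apply: (@barrier _ (fun t => w t - K) T0 T1) => //.
- move=> s Ts; apply: cvgB; last exact: cvg_cst.
  exact/cw/ltW.
- move=> s /andP[Ts sT]; rewrite subr_gt0; apply: (le_lt_trans Kc).
  have : w c <= w s by apply: cmin; rewrite in_itv/= sT ltW.
  by apply: lt_le_trans; rewrite ltrBlDr ltrDl.
- move=> s Ts /eqP; rewrite subr_eq0 => /eqP ws before.
  have [||u u1|u u1 u2] := step K T0 s K0 T0_gt0 _ _ PT0 ws.
  + have := HT2 s (le_trans T21 (ltW Ts)).
    by apply: lt_le_trans; rewrite ltrDl.
  + exact: lt_trans Ts.
  + by rewrite -subr_ge0; exact: before.
  + by exists u => //; rewrite subr_lt0.
- by near: t; apply: nbhs_pinfty_gt; exact: num_real.
Unshelve. all: end_near. Qed.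

(** * The delayed maximum and the history interval *)

Lemma max_on_le (R : realType) (c d M : R) (f : R -> R) : c <= d ->
  (forall s, c <= s <= d -> f s <= M) -> max_on c d f <= M.
Proof.
move=> cd fM; apply: ge_sup.
  by exists (f c); exists c => //=; rewrite in_itv/= lexx.
by move=> _ [s + <-]; rewrite /= in_itv/=; exact: fM.
Qed.

Lemma le_max_on (R : realType) (c d s M : R) (f : R -> R) : c <= s <= d ->
  (forall s, c <= s <= d -> f s <= M) -> f s <= max_on c d f.
Proof.
move=> csd fM; apply: ub_le_sup; last by exists s => //=; rewrite in_itv.
by exists M => _ [u + <-]; rewrite /= in_itv/=; exact: fM.
Qed.

(** The point t = 0 bounds the infimum by - tau 0; if the set has no infimum,
    [inf] takes the value 0. *)
Lemma opp_taubar_le0 (R : realType) (tau : R -> R) : 0 <= tau 0 ->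
  - taubar tau <= 0.
Proof.
move=> tau0; rewrite /taubar opprK; set E := [set _ | _ in _].
have [hE|/inf_out->//] := pselect (has_inf E).
apply: (@le_trans _ _ (0 - tau 0)); last by rewrite sub0r oppr_le0.
by apply: ge_inf; [case: hE|exists 0 => //=; rewrite in_itv/= lexx].
Qed.

(** * Comparison of solutions with exponentials of the integral *)

Section comparison.
Variables (R : realType) (tau g x I : R -> R) (a b delta1 beta : R).
Hypothesis tau_ge0 : forall t : R, 0 <= t -> 0 <= tau t.
Hypothesis tau_lim : t - tau t @[t --> +oo] --> +oo.
Hypothesis I_nondecr : forall s t, 0 <= s -> s <= t -> I s <= I t.
Hypothesis I_ln : forall eps, 0 < eps -> exists2 T : R, 0 < T &
  forall s t, T <= s -> s <= t -> I t - I s <= eps * (ln t - ln s).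
Hypothesis I_tau : I t - I (t - tau t) @[t --> +oo] --> (1 : R).
Hypothesis b_gt0 : 0 < b.
Hypothesis b_lt_a : b < a.
Hypothesis g_cont : {within `[0, +oo[, continuous g}.
Hypothesis g0 : g 0 = 0.
Hypothesis g_gt0 : forall u : R, 0 < u -> 0 < g u.
Hypothesis delta1_gt0 : 0 < delta1.
Hypothesis g_derivable : forall u : R, 0 < u < delta1 -> derivable g u 1.
Hypothesis g'_gt0 : forall u : R, 0 < u < delta1 -> 0 < derive1 g u.
Hypothesis beta_gt0 : 0 < beta.
Hypothesis g'_RV : RV0 (derive1 g) (beta - 1).
Hypothesis x_gt0 : forall t, 0 < t -> 0 < x t.
Hypothesis dx : forall t : R, 0 < t -> is_derive t 1 x (rhs tau a b g x t).
Hypothesis x_lim : x t @[t --> +oo] --> (0 : R).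

Let a_gt0 : 0 < a. Proof. exact: lt_trans b_lt_a. Qed.
Let ab_gt0 : 0 < a / b. Proof. exact: divr_gt0. Qed.
Let lnab_gt0 : 0 < ln (a / b).
Proof. by rewrite ln_gt0// ltr_pdivlMr// mul1r. Qed.

Let dlnx (t : R) : 0 < t ->
  is_derive t 1 (fun t => ln (x t)) ((x t)^-1 * rhs tau a b g x t).
Proof.
by move=> t0; apply: is_derive1_comp _ (dx t0); apply: is_derive1_ln; exact: x_gt0.
Qed.

(** I is eventually Lipschitz with respect to ln, hence continuous. *)
Lemma lnx_I_continuous rho :
  \forall t \near +oo, {for t, continuous (fun t => ln (x t) + rho * I t)}.
Proof.
have [T T0 HT] := I_ln ltr01.
near=> t.
have Tt : T < t by near: t; apply: nbhs_pinfty_gt; exact: num_real.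
have t0 := lt_trans T0 Tt.
apply: cvgD.
  apply: (@differentiable_continuous _ _ _ t (fun t => ln (x t))).
  by apply/derivable1_diffP; have [] := dlnx t0.
apply: cvgM; first exact: cvg_cst.
apply/cvgrPdist_lt => e e0; near=> s.
have Ts : T < s by near: s; exact: lt_nbhsr.
have : `|ln t - ln s| < e.
  near: s; move: e e0; apply/cvgrPdist_lt; exact: continuous_ln.
have s0 := lt_trans T0 Ts.
have [st|ts] := leP s t.
  rewrite !ger0_norm ?subr_ge0 ?ler_ln ?posrE ?I_nondecr ?(ltW s0)//.
  by apply: le_lt_trans; have := HT _ _ (ltW Ts) st; rewrite mul1r.
have ts' := ltW ts.
rewrite distrC [X in _ -> X < _]distrC.
rewrite !ger0_norm ?subr_ge0 ?ler_ln ?posrE ?I_nondecr ?(ltW t0)//.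
by apply: le_lt_trans; have := HT _ _ (ltW Tt) ts'; rewrite mul1r.
Unshelve. all: end_near. Qed.

Let lt_powR_expR c rho : 0 < c -> ln c < beta * rho -> c < expR rho `^ beta.
Proof.
by move=> c0 h; rewrite -ltr_ln ?posrE ?powR_gt0 ?expR_gt0// ln_powR expRK.
Qed.

Let gt_powR_expR c rho : 0 < c -> beta * rho < ln c -> expR rho `^ beta < c.
Proof.
by move=> c0 h; rewrite -ltr_ln ?posrE ?powR_gt0 ?expR_gt0// ln_powR expRK.
Qed.

(** Lower barrier: at a first contact the delayed term wins and x increases,
    while exp(- rho I) is nonincreasing. *)
Lemma ln_x_ge rho : beta^-1 * ln (a / b) < rho ->
  exists K, \forall t \near +oo, - rho * I t + K <= ln (x t).
Proof.
move=> rrho; set r := beta^-1 * ln (a / b) in rrho.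
have r0 : 0 < r by rewrite mulr_gt0 ?invr_gt0.
have rho0 := lt_trans r0 rrho.
pose rho' := (r + rho) / 2.
have [rr' r'rho] : r < rho' /\ rho' < rho by rewrite /rho'; split; lra.
pose lambda := expR rho'; have l0 : 0 < lambda by exact: expR_gt0.
have labl : a / b < lambda `^ beta.
  by apply: lt_powR_expR => //; rewrite -ltr_pdivrMl.
pose M := (a / b + lambda `^ beta) / 2.
have [abM Ml] : a / b < M /\ M < lambda `^ beta by rewrite /M; split; lra.
have pq : 0 < - M + 1 * lambda `^ beta by lra.
have [d d0 dP] := near_right0_ex
  (rv_lincomb g_cont g0 delta1_gt0 g_derivable g'_gt0 g'_RV l0 pq).
pose P t := [/\ x t < d, x t < delta1 / 2 & rho' / rho < I t - I (t - tau t)].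
have nearP : \forall t \near +oo, P t.
  near=> t; split; near: t.
  - exact: cvgr_lt x_lim _ d0.
  - by apply: cvgr_lt x_lim _ _; rewrite divr_gt0.
  - by apply: cvgr_gt I_tau _ _; rewrite ltr_pdivrMr// mul1r.
have [|K HK] := eventual_lower_bound tau_lim (lnx_I_continuous rho) nearP.
  move=> K T0 t _ T0_gt0 Th T0t PT0 wt before.
  have t0 : 0 < t by exact: lt_trans T0t.
  have ht : t - tau t <= t by rewrite gerBl; apply: tau_ge0; exact: ltW.
  have h0 : 0 < t - tau t by exact: lt_trans Th.
  have [xd xd1 rI] := PT0 _ (ltW T0t).
  have [_ xhd1 _] := PT0 _ (ltW Th).
  have xt0 := x_gt0 t0; have xh0 := x_gt0 h0.
  have lx : lambda * x t <= x (t - tau t).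
    rewrite -ler_ln ?posrE ?mulr_gt0// lnM ?posrE// expRK.
    have := before (t - tau t); rewrite Th ht => /(_ isT).
    move: rI; rewrite ltr_pdivrMr// => rI; rewrite -wt; lra.
  have gM : M * g (x t) <= g (lambda * x t).
    by have := dP _ xt0 xd; rewrite mul1r mulNr addrC subr_ge0.
  have half : delta1 / 2 < delta1 by rewrite ltr_pdivrMr// ltr_pMr ?ltr1n.
  have mono u v : 0 <= u -> u <= v -> v < delta1 -> g u <= g v.
    exact: g_nondecr.
  have gh : g (lambda * x t) <= g (x (t - tau t)).
    apply: mono => //; first by rewrite mulr_ge0 ?ltW.
    exact: lt_trans half.
  have gmax : g (x (t - tau t)) <= max_on (t - tau t) t (g \o x).
    apply: (@le_max_on _ _ _ _ (g (delta1 / 2)) (g \o x)); first by rewrite lexx.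
    move=> s /andP[hs st]; have Ts := lt_le_trans Th hs.
    have [_ xs _] := PT0 _ (ltW Ts).
    by apply: mono => //; [exact/ltW/x_gt0/(lt_trans T0_gt0)|exact: ltW].
  have D0 : 0 < rhs tau a b g x t.
    rewrite /rhs mulNr addrC subr_gt0.
    have : b * (M * g (x t)) <= b * max_on (t - tau t) t (g \o x).
      by rewrite ler_pM2l// (le_trans gM)// (le_trans gh).
    apply: lt_le_trans; rewrite mulrA ltr_pM2r ?g_gt0//.
    by rewrite mulrC -ltr_pdivrMr.
  have [s /andP[Ts st] xs] := derive_gt0_left (dx t0) D0 T0t.
  exists s; first by rewrite Ts.
  have s0 := lt_trans T0_gt0 Ts.
  rewrite -wt ltr_leD//; first by rewrite ltr_ln ?posrE ?x_gt0.
  by rewrite ler_pM2l// I_nondecr// ltW.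
exists K; apply: filterS HK => t; lra.
Unshelve. all: end_near. Qed.

(** Upper barrier: at a first contact ln x decreases at least like a fixed
    multiple of ln, while rho I increases at most like an arbitrarily small
    multiple of ln. *)
Lemma ln_x_le rho : 0 < rho < beta^-1 * ln (a / b) ->
  exists K, \forall t \near +oo, ln (x t) <= - rho * I t + K.
Proof.
move=> /andP[rho0 rhor]; set r := beta^-1 * ln (a / b) in rhor.
pose rho' := (r + rho) / 2.
have [rr' r'rho] : rho < rho' /\ rho' < r by rewrite /rho'; split; lra.
pose lambda := expR rho'; have l0 : 0 < lambda by exact: expR_gt0.
have labl : lambda `^ beta < a / b.
  by apply: gt_powR_expR => //; rewrite -ltr_pdivlMl.
pose M := (a / b + lambda `^ beta) / 2.
have [abM Ml] : M < a / b /\ lambda `^ beta < M by rewrite /M; split; lra.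
have pq : 0 < M + (-1) * lambda `^ beta by lra.
have [d d0 dP] := near_right0_ex
  (rv_lincomb g_cont g0 delta1_gt0 g_derivable g'_gt0 g'_RV l0 pq).
pose kappa := a - b * M.
have kappa0 : 0 < kappa by rewrite subr_gt0 mulrC -ltr_pdivlMr.
have bb : beta < beta + 1 by rewrite ltrDl.
(* The exponent beta + 1 gives g(z)/z >= exp(K0) z^beta, and z^beta is at least
   exp(- beta rho I) along the barrier. *)
have [K0 /near_right0_ex[d' d'0 d'P]] := ln_g_ge g_cont g0 g_gt0 delta1_gt0
  g_derivable g'_gt0 g'_RV bb.
(* With this slope, exp(- beta rho I(t)) >= exp(- C) / t. *)
have br0 : 0 < (beta * rho)^-1 by rewrite invr_gt0 mulr_gt0.
have [T' T'0 HT'] := I_ln br0.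
pose C := beta * rho * I T' - ln T'.
(* Half of the value for which the decay rate kappa exp(K0 - C) / t of ln x
   would only match the rate rho eps / t allowed to the barrier. *)
pose eps := kappa * expR (K0 - C) / rho / 2.
have eps0 : 0 < eps by rewrite !divr_gt0// mulr_gt0 ?expR_gt0.
have [Te Te0 HTe] := I_ln eps0.
pose P t := [/\ [/\ x t < d, x t < d' & lambda * x t < delta1],
  rho * (I t - I (t - tau t)) < rho', T' <= t & Te <= t].
have nearP : \forall t \near +oo, P t.
  near=> t; split; first split; near: t.
  - exact: cvgr_lt x_lim _ d0.
  - exact: cvgr_lt x_lim _ d'0.
  - have dl : 0 < delta1 / lambda by rewrite divr_gt0.
    by apply: filterS (cvgr_lt _ x_lim _ dl) => u; rewrite ltr_pdivlMr// mulrC.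
  - have r1 : 1 < rho' / rho by rewrite ltr_pdivlMr// mul1r.
    by apply: filterS (cvgr_lt _ I_tau _ r1) => u; rewrite ltr_pdivlMr// mulrC.
  - by apply: nbhs_pinfty_ge; exact: num_real.
  - by apply: nbhs_pinfty_ge; exact: num_real.
have cw : \forall t \near +oo,
    {for t, continuous (fun t => - (ln (x t) + rho * I t))}.
  apply: filterS (lnx_I_continuous rho) => t ct; exact: cvgN.
have [|K HK] := eventual_lower_bound tau_lim cw nearP.
  move=> K T0 t Kle0 T0_gt0 Th T0t PT0 wt before.
  have t0 : 0 < t by exact: lt_trans T0t.
  have ht : t - tau t <= t by rewrite gerBl; apply: tau_ge0; exact: ltW.
  have h0 : 0 < t - tau t by exact: lt_trans Th.
  have [[xd xd' xd1] rI T't Tet] := PT0 _ (ltW T0t).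
  have xt0 := x_gt0 t0.
  have gM : g (lambda * x t) <= M * g (x t).
    by have := dP _ xt0 xd; rewrite mulN1r subr_ge0.
  have gmax : max_on (t - tau t) t (g \o x) <= M * g (x t).
    apply: max_on_le => // s /andP[hs st] /=; apply: le_trans gM.
    have Ts := lt_le_trans Th hs; have xs0 := x_gt0 (lt_trans T0_gt0 Ts).
    apply: (g_nondecr g_cont g_derivable g'_gt0) => //; first exact: ltW.
    rewrite -ler_ln ?posrE ?mulr_gt0// lnM ?posrE// expRK.
    have := before s; rewrite Ts st => /(_ isT).
    have : rho * I (t - tau t) <= rho * I s by rewrite ler_pM2l// I_nondecr// ltW.
    move: rI; lra.
  have D : rhs tau a b g x t <= - kappa * g (x t).
    rewrite /rhs /kappa.
    have : b * max_on (t - tau t) t (g \o x) <= b * (M * g (x t)).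
      by rewrite ler_pM2l.
    lra.
  have lnxt : - (rho * I t) <= ln (x t) by lra.
  have It : beta * rho * I t <= C + ln t.
    have := HT' _ _ (lexx _) T't; rewrite ler_pdivlMl ?mulr_gt0// /C; lra.
  have gx : expR (K0 - C) / t <= g (x t) / x t.
    rewrite -ler_ln ?posrE ?divr_gt0 ?expR_gt0 ?g_gt0// !ln_div ?posrE ?expR_gt0 ?g_gt0//.
    rewrite expRK; have := d'P _ xt0 xd'.
    have : beta * - (rho * I t) <= beta * ln (x t) by rewrite ler_pM2l.
    lra.
  (* -phi = rho eps ln + ln x decreases strictly at t, and its variation
     dominates that of ln x + rho I. *)
  pose phi s := - (rho * eps * ln s + ln (x s)).
  have dphi : is_derive t 1 phi
      (- (rho * eps * t^-1 + (x t)^-1 * rhs tau a b g x t)).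
    apply: is_deriveN; apply: is_deriveD; last exact: dlnx.
    by apply: is_deriveZ; exact: is_derive1_ln.
  have dphi0 : 0 < - (rho * eps * t^-1 + (x t)^-1 * rhs tau a b g x t).
    rewrite oppr_gt0.
    have : (x t)^-1 * rhs tau a b g x t <= (x t)^-1 * (- kappa * g (x t)).
      by rewrite ler_pM2l// invr_gt0.
    have -> : (x t)^-1 * (- kappa * g (x t)) = - (kappa * (g (x t) / x t)).
      by ring.
    have : kappa * (expR (K0 - C) / t) <= kappa * (g (x t) / x t).
      by rewrite ler_pM2l.
    have -> : rho * eps * t^-1 = kappa * (expR (K0 - C) / t) / 2.
      by rewrite /eps; field; rewrite !gt_eqF.
    have : 0 < kappa * (expR (K0 - C) / t).
      by rewrite mulr_gt0// divr_gt0// expR_gt0.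
    lra.
  have [s /andP[Ts st] phis] := derive_gt0_left dphi dphi0 T0t.
  exists s; first by rewrite Ts.
  have [_ _ _ Tes] := PT0 _ (ltW Ts).
  have : rho * (I t - I s) <= rho * (eps * (ln t - ln s)).
    by rewrite ler_pM2l//; apply: HTe => //; exact: ltW.
  move: phis wt; rewrite /phi; lra.
exists (- K); apply: filterS HK => t; lra.
Unshelve. all: end_near. Qed.

End comparison.

(** * The logarithmic decay rate *)

Theorem theorem24 (R : realType) (tau sigma g psi x : R -> R)
    (a b delta1 beta : R)
    (tau_cont : {within `[0, +oo[, continuous tau})
    (tau_ge0 : forall t : R, 0 <= t -> 0 <= tau t)
    (tau_lim : t - tau t @[t --> +oo] --> +oo)
    (sigma_cont : {within `[- taubar tau, +oo[, continuous sigma})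
    (sigma_ge0 : forall t : R, - taubar tau <= t -> 0 <= sigma t)
    (sigma_fin : forall c d : R, - taubar tau <= c -> c <= d ->
       (recip_int_ereal sigma c d < +oo)%E)
    (sigma_int_lim : recip_int sigma 0 t @[t --> +oo] --> +oo)
    (sigma_lim : sigma t @[t --> +oo] --> +oo)
    (sigma_tau_lim : recip_int sigma (t - tau t) t @[t --> +oo] --> (1 : R))
    (sigma_superlin : sigma t / t @[t --> +oo] --> +oo)
    (b_gt0 : 0 < b) (b_lt_a : b < a)
    (g_cont : {within `[0, +oo[, continuous g})
    (g0 : g 0 = 0)
    (g_gt0 : forall u : R, 0 < u -> 0 < g u)
    (delta1_gt0 : 0 < delta1)
    (g_derivable : forall u : R, 0 < u < delta1 -> derivable g u 1)
    (g'_cont : forall u : R, 0 < u < delta1 -> {for u, continuous (derive1 g)})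
    (g'_gt0 : forall u : R, 0 < u < delta1 -> 0 < derive1 g u)
    (beta_gt1 : 1 < beta)
    (g'_RV : RV0 (derive1 g) (beta - 1))
    (psi_cont : {within `[- taubar tau, 0], continuous psi})
    (psi_gt0 : forall t : R, - taubar tau <= t <= 0 -> 0 < psi t)
    (x_sol : is_solution tau a b g psi x)
    (x_lim : x t @[t --> +oo] --> (0 : R)) :
  let log_g_limit :=
    ln (g (x t)) / recip_int sigma 0 t @[t --> +oo] --> - ln (a / b) in
  let log_x_limit :=
    ln (x t) / recip_int sigma 0 t @[t --> +oo] --> - (beta^-1 * ln (a / b)) in
  [/\ log_g_limit, (log_g_limit <-> log_x_limit) & log_x_limit].
Proof.
move=> log_g_limit log_x_limit.
have c0 := opp_taubar_le0 (tau_ge0 0 (lexx _)).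
have [_ x_gt0' _ dx _] := x_sol.
have x_gt0 t : 0 < t -> 0 < x t.
  by move=> t0; apply: x_gt0'; exact/(le_trans c0)/ltW.
pose I t := recip_int sigma 0 t.
have I_split s t : 0 <= s -> s <= t -> I t - I s = recip_int sigma s t.
  move=> s0 st; rewrite /I (recip_int_split sigma_cont sigma_ge0 sigma_fin c0 s0 st).
  by rewrite addrC addKr.
have I_nondecr s t : 0 <= s -> s <= t -> I s <= I t.
  move=> s0 st; rewrite -subr_ge0 I_split//.
  by apply: (recip_int_ge0 sigma_ge0); exact: le_trans s0.
have I_ln eps : 0 < eps -> exists2 T : R, 0 < T &
    forall s t, T <= s -> s <= t -> I t - I s <= eps * (ln t - ln s).
  move=> e0; have [T T0 HT] :=
    recip_int_le_ln sigma_cont sigma_ge0 c0 sigma_superlin e0.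
  exists T => // s t Ts st; rewrite I_split//; first exact: HT.
  exact/ltW/(lt_le_trans T0).
(* The two integrals agree once t - tau t >= 0. *)
have I_tau : I t - I (t - tau t) @[t --> +oo] --> (1 : R).
  move: sigma_tau_lim; apply: cvg_trans; apply: near_eq_cvg; near=> t.
  have t0 : 0 <= t by near: t; apply: nbhs_pinfty_ge; exact: num_real.
  rewrite I_split//; last by rewrite gerBl tau_ge0.
  by near: t; move/cvgryPge : tau_lim; exact.
have beta_gt0 : 0 < beta by exact: lt_trans beta_gt1.
have r0 : 0 < beta^-1 * ln (a / b).
  by rewrite mulr_gt0 ?invr_gt0// ln_gt0// ltr_pdivlMr// mul1r.
have limx : log_x_limit.
  rewrite /log_x_limit.
  apply: (@cvg_ratio _ _ _ _ (fun t => ln (x t)) _ _ _ r0 sigma_int_lim) => s.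
    move=> /andP[ls]; rewrite addNr => s0.
    have rho : 0 < - s < beta^-1 * ln (a / b) by rewrite oppr_gt0 s0 ltrNl.
    have [K HK] := ln_x_le tau_ge0 tau_lim I_nondecr I_ln I_tau b_gt0 b_lt_a
      g_cont g0 g_gt0 delta1_gt0 g_derivable g'_gt0 beta_gt0 g'_RV x_gt0 dx
      x_lim rho.
    by exists K; move: HK; rewrite opprK.
  move=> /andP[_ sl].
  have rho : beta^-1 * ln (a / b) < - s by rewrite ltrNr.
  have [K HK] := ln_x_ge tau_ge0 tau_lim I_nondecr I_ln I_tau b_gt0 b_lt_a
    g_cont g0 g_gt0 delta1_gt0 g_derivable g'_gt0 beta_gt0 g'_RV x_gt0 dx
    x_lim rho.
  by exists K; move: HK; rewrite opprK.
have x_right : x t @[t --> +oo] --> 0^'+.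
  move=> P /near_right0_ex[d d0 dP]; rewrite nbhs_filterE /=.
  suff : \forall t \near +oo, P (x t) by [].
  near=> t; apply: dP.
    by apply: x_gt0; near: t; apply: nbhs_pinfty_gt; exact: num_real.
  by near: t; exact: cvgr_lt x_lim _ d0.
have limg : log_g_limit.
  rewrite /log_g_limit; have ratio := cvg_comp _ _ x_right
    (ln_g_ratio g_cont g0 g_gt0 delta1_gt0 g_derivable g'_gt0 g'_RV).
  have /(_ _) := cvgM ratio limx.
  rewrite mulrN mulrA divff ?gt_eqF// mul1r; apply: cvg_trans.
  apply: near_eq_cvg; near=> t => /=.
  have x0 : 0 < x t < 1.
    rewrite x_gt0/=; first by near: t; exact: cvgr_lt x_lim _ ltr01.
    by near: t; apply: nbhs_pinfty_gt; exact: num_real.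
  by rewrite mulrA divfK// lt_eqF// ln_lt0.
by split.
Unshelve. all: end_near. Qed.
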